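(* Let $R$ be a finite Frobenius ring, let $m\ge 1$, let $C$ be a left $R$-linear code of length $n$ with right dual code $C^{\perp}$, and let $f\in\mathrm{Harm}_d(n)$. Let $W^{[m]}_{C,f}(x,y)$ be the $m$-tuple harmonic weight enumerator of $C$ associated to $f$. Then $$W^{[m]}_{C,f}(x,y)=(xy)^d\,Z^{[m]}_{C,f}(x,y),$$ where $Z^{[m]}_{C,f}$ is a homogeneous polynomial of degree $n-2d$ satisfying $$Z^{[m]}_{C^{\perp},f}(x,y)=(-1)^d\,\frac{(|R|^m)^d}{|C|^m}\,Z^{[m]}_{C,f}\bigl(x+(|R|^m-1)y,\;x-y\bigr),$$ where $Z^{[m]}_{C^\perp,f}$ is the polynomial with $W^{[m]}_{C^\perp,f}(x,y)=(xy)^d Z^{[m]}_{C^\perp,f}(x,y)$.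
   Context: Let $E=\{1,\dots,n\}$, let $0\le d\le n$, and let $E_d$ be the set of $d$-element subsets of $E$. $\mathbb{R}E_d$ is the real vector space with basis $E_d$; its elements $f=\sum_{Z\in E_d}f(Z)Z$ are identified with functions $E_d\to\mathbb{R}$. The linear map $\gamma$ on $\mathbb{R}E_d$ is given by $\gamma(Z)=\sum_{Y\in E_{d-1},\,Y\subseteq Z}Y$ for $Z\in E_d$ (and $\gamma=0$ if $d=0$), and $\mathrm{Harm}_d(n)=\ker(\gamma|_{\mathbb{R}E_d})$. For $f\in\mathbb{R}E_d$ and $X\subseteq E$ put $\widetilde f(X)=\sum_{Z\in E_d,\,Z\subseteq X}f(Z)$. Rings are associative with identity. A finite ring $R$ is Frobenius if $R/\mathrm{Rad}(R)\cong\mathrm{Soc}(R_R)$ as right $R$-modules and $R/\mathrm{Rad}(R)\cong\mathrm{Soc}({}_RR)$ as left $R$-modules, where $\mathrm{Rad}$ is the Jacobson radical and $\mathrm{Soc}$ the socle. A left (right) $R$-linear code of length $n$ is a left (right) $R$-submodule of $R^n$. With $\mathbf{u}\cdot\mathbf{v}=\sum_i u_iv_i$, the right dual code of a left $R$-linear code $C$ is $C^\perp=\{\mathbf{u}\in R^n:\mathbf{v}\cdot\mathbf{u}=0\text{ for all }\mathbf{v}\in C\}$, a right $R$-linear code. The support of $\mathbf{u}$ is $\mathrm{supp}(\mathbf{u})=\{i\in E: u_i\ne 0\}$. For a left or right $R$-linear code $C$ of length $n$ and $X\subseteq E$, let $A^{[m]}_C(X)$ be the number of $(\mathbf{u}_1,\dots,\mathbf{u}_m)\in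 C^m$ with $\mathrm{supp}(\mathbf{u}_1)\cup\dots\cup\mathrm{supp}(\mathbf{u}_m)=X$. The $m$-tuple harmonic weight enumerator of $C$ associated to $f\in\mathrm{Harm}_d(n)$ is $$W^{[m]}_{C,f}(x,y)=\sum_{X\subseteq E}\widetilde f(X)A^{[m]}_C(X)x^{|E-X|}y^{|X|}.$$ The zero polynomial is regarded as homogeneous of every degree. *)

(* Defs.v *)
From mathcomp Require Import all_boot all_order all_algebra.
From mathcomp Require Import reals mpoly.

Set Implicit Arguments.
Unset Strict Implicit.
Unset Printing Implicit Defensive.

Import GRing.Theory.
Local Open Scope ring_scope.

Section Frobenius.
Variable R : finPzRingType.
Implicit Types I J S : {set R}.

Definition addsubgroup I : bool :=
  (0 \in I) && [forall x in I, forall y in I, x - y \in I].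

Definition left_ideal I : bool :=
  addsubgroup I && [forall a, forall x in I, a * x \in I].

Definition right_ideal I : bool :=
  addsubgroup I && [forall a, forall x in I, x * a \in I].

Definition maximal_left_ideal I : bool :=
  maxset (fun J => left_ideal J && (J != [set: R])) I.

Definition minimal_left_ideal I : bool :=
  minset (fun J => left_ideal J && (J != [set 0])) I.

Definition minimal_right_ideal I : bool :=
  minset (fun J => right_ideal J && (J != [set 0])) I.

(* The Jacobson radical; using right ideals instead gives the same set. *)
Definition jacobson_rad : {set R} := \bigcap_(I | maximal_left_ideal I) I.

(* The sum of the additive subgroups [I] with [P I]. *)
Definition sum_ideals (P : pred {set R}) : {set R} :=
  [set x | [exists u : {ffun {set R} -> R},
     [forall (I | P I), u I \in I] && (x == \sum_(I | P I) u I)]].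

Definition left_socle : {set R} := sum_ideals minimal_left_ideal.
Definition right_socle : {set R} := sum_ideals minimal_right_ideal.

(* Elements of [R / J] are represented by the cosets [x + J]. *)
Definition add_coset J (x : R) : {set R} := [set x + y | y in J].
Definition add_quotient J : {set {set R}} := [set add_coset J x | x : R].

Definition quotient_add_iso J S (phi : {set R} -> R) : Prop :=
  [/\ {in add_quotient J &, injective phi},
      phi @: add_quotient J = S
    & forall x y, phi (add_coset J (x + y)) =
                  phi (add_coset J x) + phi (add_coset J y)].

Definition left_module_iso J S : Prop :=
  exists2 phi : {set R} -> R, quotient_add_iso J S phi &
    forall a x, phi (add_coset J (a * x)) = a * phi (add_coset J x).

Definition right_module_iso J S : Prop :=
  exists2 phi : {set R} -> R, quotient_add_iso J S phi &
    forall a x, phi (add_coset J (x * a)) = phi (add_coset J x) * a.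

Definition frobenius : Prop :=
  right_module_iso jacobson_rad right_socle /\
  left_module_iso jacobson_rad left_socle.

End Frobenius.

Section Codes.
Variables (R : finPzRingType) (n : nat).
Implicit Types (C : {set 'rV[R]_n}) (u v : 'rV[R]_n).

Definition left_linear_code C : Prop := submod_closed C.

Definition dotv u v : R := \sum_(i < n) u 0 i * v 0 i.

Definition right_dual C : {set 'rV[R]_n} :=
  [set u | [forall v in C, dotv v u == 0]].

Definition supp u : {set 'I_n} := [set i | u 0 i != 0].

Definition supp_count (m : nat) C (X : {set 'I_n}) : nat :=
  #|[set u : {ffun 'I_m -> 'rV[R]_n} |
      [forall i, u i \in C] && (\bigcup_i supp (u i) == X)]|.

End Codes.

Notation dsubset n d := {Z : {set 'I_n} | #|Z| == d}.

(* [K^o] is [K] as a module over itself, so that [RE K n d] is a [K]-module. *)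
Notation RE K n d := {ffun dsubset n d -> K^o}.

Section Harmonic.
Variables (K : realType) (n : nat).

Definition basis_elt (d : nat) (Z : dsubset n d) : RE K n d :=
  [ffun Z' => (Z' == Z)%:R].

(* For [d = 0] the index [d.-1] is a dummy: the value is [0]. *)
Definition gamma_basis (d : nat) (Z : dsubset n d) : RE K n d.-1 :=
  if d == 0%N then 0
  else \sum_(Y : dsubset n d.-1 | val Y \subset val Z) basis_elt Y.

Definition gamma (d : nat) (f : RE K n d) : RE K n d.-1 :=
  \sum_(Z : dsubset n d) f Z *: gamma_basis Z.

Definition harmonic (d : nat) (f : RE K n d) : Prop := gamma f = 0.

Definition ftilde (d : nat) (f : RE K n d) (X : {set 'I_n}) : K :=
  \sum_(Z : dsubset n d | val Z \subset X) f Z.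

End Harmonic.

Section Enumerator.
Variable K : realType.

Definition poly_x : {mpoly K[2]} := 'X_ord0.
Definition poly_y : {mpoly K[2]} := 'X_ord_max.

Definition whe (R : finPzRingType) (n d m : nat) (C : {set 'rV[R]_n})
    (f : RE K n d) : {mpoly K[2]} :=
  \sum_(X : {set 'I_n})
    (ftilde f X * (supp_count m C X)%:R) *: (poly_x ^+ #|~: X| * poly_y ^+ #|X|).

(* Homogeneity of integer degree: the zero polynomial is homogeneous of every
   degree, and no other polynomial is homogeneous of a negative degree. *)
Definition zhomog (k : int) (p : {mpoly K[2]}) : Prop :=
  match k with
  | Posz j => p \is j.-homog
  | Negz _ => p = 0
  end.

(* [subst2 p a b] is [p(a, b)]. *)
Definition subst2 (p a b : {mpoly K[2]}) : {mpoly K[2]} :=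
  p \mPo [tuple a; b].

End Enumerator.

(* Main.v *)
Require Import Defs.
From mathcomp Require Import all_boot all_order all_algebra.
From mathcomp Require Import reals mpoly.

Set Implicit Arguments.
Unset Strict Implicit.
Unset Printing Implicit Defensive.

Import GRing.Theory.
Local Open Scope ring_scope.

(** Two facts carry the theorem, one about codes and one about harmonic
    functions.

    For a set X of coordinates let C(X) be the subcode of the words of C with
    support in X.  Over a Frobenius ring the subcodes of C and of its dual
    determine each other through
      |C^perp(X)| |C| = |R|^|X| |C(E - X)|   [card_subcode_dual],
    which is the size formula |D| |D^perp| = |R|^n [card_code_dual] for the
    code D of the words that agree on X with a word of C.  The size formula
    follows from the inequality saying that |D| |D^perp| can only grow with D:
    at the two ends {0} and R^n the product is |R|^n, so it is constant.  When
    D grows by a simple module R/M, this inequality reduces to the bound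
    |ann(M)| |M| <= |R| for the right annihilator of a maximal left ideal M
    [leq_card_right_ann], which is where the Frobenius property enters: ann(M)
    lies in the left socle, so it is carried into R/J, with J the Jacobson
    radical, and the bound becomes
      |{b | M b in J}| |M| <= |J| |R|   [leq_card_radical_quotient_ann].
    Over the semisimple ring R/J this says that Hom(V, R/J) is not larger than
    V = R/M; indeed Hom(V, R/J) embeds into the dual of V over the finite
    division ring End(V).

    On the harmonic side, the multilinear form
      F(g) = sum over Z of f(Z) times the product of g over Z
    is invariant under adding a constant to g [harmonic_eval_addc], since the
    sums of f over the supersets of a smaller set vanish.  Hence, when g is s
    on X and t off X, F(g) = f~(X) (s - t)^d [harmonic_eval_two_values].  This
    gives f~(E - X) = (-1)^d f~(X), so that f~ vanishes on the sets with fewer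
    than d elements and on their complements, and W is divisible by (xy)^d.
    It also gives, for the subcode sizes B(X) = |C(X)|^m,
      sum of f~(X) B(X) a^|E-X| b^|X| = (a b)^d Z(a + b, b)
    [weighted_enum_down_sums].  In this sum, passing to the dual code amounts
    to complementing X and rescaling, so it is the sum for C with a and b
    exchanged and one of them multiplied by |R|^m.  Taking a = x - y, b = y and
    cancelling ((x - y) y)^d gives the identity. *)

(** * Ideals of a finite ring *)

(** A counting form of the first isomorphism theorem that asks for neither a
    morphism nor a group: on each fibre of [f] the differences of [g] lie in
    [K], so a fibre has at most [#|K|] points. *)
Lemma leq_card_fibers (T U : finType) (V : finZmodType) (A : {set T})
    (B : {set U}) (K : {set V}) (f : T -> U) (g : T -> V) :
  {in A, forall x, f x \in B} ->
  {in A &, forall x y, f x = f y -> g x - g y \in K} ->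
  {in A &, forall x y, f x = f y -> g x = g y -> x = y} ->
  (#|A| <= #|B| * #|K|)%N.
Proof.
move=> fB gK inj_fg.
pose rep x := odflt x [pick y in A | f y == f x].
have repP x : x \in A -> rep x \in A /\ f (rep x) = f x.
  by rewrite /rep; case: pickP => [y /andP[yA /eqP] | _] /= xA.
have rep_eq x y : x \in A -> y \in A -> f x = f y -> rep x = rep y.
  move=> xA yA fxy; rewrite /rep fxy.
  by case: pickP => // /(_ y); rewrite yA eqxx.
pose h x := (f x, g x - g (rep x)).
rewrite -cardsX -(@card_in_imset _ _ h) => [|x y xA yA [fxy]]; last first.
  by rewrite (rep_eq x y) // => /addIr; apply: inj_fg.
apply/subset_leq_card/subsetP=> _ /imsetP[x xA ->].
have [rA frx] := repP x xA.
by rewrite in_setX fB //= gK.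
Qed.

Section RingIdeals.
Variable R : finPzRingType.
Implicit Types (a b c e r x y : R) (I L M W : {set R}).

Lemma addsubgroupP W :
  reflect (0 \in W /\ {in W &, forall x y, x - y \in W}) (addsubgroup W).
Proof.
apply: (iffP andP) => -[W0 WB]; split=> //.
  by move=> x y xW yW; move/forall_inP: WB => /(_ x xW)/forall_inP; apply.
by apply/forall_inP=> x xW; apply/forall_inP=> y; apply: WB.
Qed.

Lemma addsubgroupD W : addsubgroup W -> {in W &, forall x y, x + y \in W}.
Proof.
move=> /addsubgroupP[W0 WB] x y xW yW.
by rewrite -[y]opprK WB // -[- y]sub0r WB.
Qed.

Lemma left_idealP L :
  reflect [/\ 0 \in L, {in L &, forall x y, x - y \in L}
            & forall a, {in L, forall x, a * x \in L}] (left_ideal L).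
Proof.
apply: (iffP andP) => [[/addsubgroupP[L0 LB] LM] | [L0 LB LM]].
  by split=> // a x xL; move/forallP: LM => /(_ a)/forall_inP; apply.
split; first exact/addsubgroupP.
by apply/forallP=> a; apply/forall_inP=> x; apply: LM.
Qed.

Lemma left_idealD L : left_ideal L -> {in L &, forall x y, x + y \in L}.
Proof. by case/andP=> /addsubgroupD. Qed.

Lemma maximal_left_idealP M :
  reflect [/\ left_ideal M, 1 \notin M
    & forall L, left_ideal L -> M \subset L -> 1 \notin L -> L = M]
    (maximal_left_ideal M).
Proof.
have properE L : left_ideal L -> (L != [set: R]) = (1 \notin L).
  case/left_idealP=> _ _ LM; apply/idP/idP; last first.
    by apply: contraNneq => ->; rewrite inE.
  apply: contraNN => L1; apply/eqP/setP=> x.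
  by rewrite inE -[x]mulr1 LM.
apply: (iffP maxsetP) => [[/andP[lM pM] maxM]|[lM M1 maxM]].
  split=> // [|L lL sML L1]; first by rewrite -properE.
  by apply: maxM => //; rewrite lL properE.
split=> [|L /andP[lL pL] sML]; first by rewrite lM properE.
by apply: maxM; rewrite -?properE.
Qed.

(** The ring [R] is the sum of [M] and the left ideal generated by [c], so [c]
    has a left inverse modulo [M]. *)
Lemma maximal_left_comaximal M c :
  maximal_left_ideal M -> c \notin M -> exists e, 1 - e * c \in M.
Proof.
case/maximal_left_idealP=> lM M1 maxM cM.
have /left_idealP[M0 MB MM] := lM.
pose L := [set x | [exists e, x - e * c \in M]].
have lL : left_ideal L.
  apply/left_idealP; split=> [|x y|a x]; rewrite ?inE.
  - by apply/existsP; exists 0; rewrite mul0r subr0.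
  - move=> /existsP[e xe] /existsP[e' ye]; apply/existsP; exists (e - e').
    by rewrite mulrBl opprD addrACA -opprD MB.
  - move=> /existsP[e xe]; apply/existsP; exists (a * e).
    by rewrite -mulrA -mulrBr MM.
apply/existsP; suff : 1 \in L by rewrite inE.
apply: contraNT cM => L1.
have sML : M \subset L.
  apply/subsetP=> x xM; rewrite inE; apply/existsP; exists 0.
  by rewrite mul0r subr0.
rewrite -(maxM L lL sML L1) inE; apply/existsP; exists 1.
by rewrite mul1r subrr.
Qed.

Definition colon L a : {set R} := [set x | x * a \in L].

Lemma left_ideal_colon L a : left_ideal L -> left_ideal (colon L a).
Proof.
case/left_idealP=> L0 LB LM.
apply/left_idealP; split=> [|x y|r x]; rewrite ?inE ?mul0r // => xL.
  by move=> yL; rewrite mulrBl LB.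
by rewrite -mulrA LM.
Qed.

(** Right multiplication by [a] embeds [R / colon M a] into the simple module
    [R / M], and it is onto because [a] is not in [M]. *)
Lemma maximal_left_colon M a :
  maximal_left_ideal M -> a \notin M -> maximal_left_ideal (colon M a).
Proof.
move=> mM aM; have /maximal_left_idealP[lM _ _] := mM.
have /left_idealP[M0 MB MM] := lM.
apply/maximal_left_idealP; split=> [||L lL sNL L1].
- exact: left_ideal_colon.
- by rewrite inE mul1r.
apply/eqP; rewrite eqEsubset sNL andbT; apply/subsetP=> x xL.
have /left_idealP[_ LB LM] := lL.
rewrite inE; apply: contraNT L1 => xaM.
have [e eM] := maximal_left_comaximal mM xaM.
rewrite -[1](subrK (a * e * x)); apply: (left_idealD lL); last exact: LM.
apply: (subsetP sNL); rewrite inE mulrBl mul1r.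
by rewrite -!mulrA -{1}[a]mulr1 -mulrBr MM.
Qed.

Lemma left_ideal_jacobson : left_ideal (jacobson_rad R).
Proof.
apply/left_idealP; split=> [|x y xJ yJ|a x xJ]; apply/bigcapP=> M mM;
  have /maximal_left_idealP[/left_idealP[M0 MB MM] _ _] := mM => //.
  by apply: MB; [move/bigcapP: xJ | move/bigcapP: yJ]; apply.
by apply: MM; move/bigcapP: xJ; apply.
Qed.

(** The radical, cut out by left ideals, is two-sided because each maximal left
    ideal [M] either contains [a] or has a maximal colon ideal [colon M a]. *)
Lemma jacobson_mulr a :
  {in jacobson_rad R, forall x, x * a \in jacobson_rad R}.
Proof.
move=> x /bigcapP xJ; apply/bigcapP=> M mM.
have /maximal_left_idealP[/left_idealP[M0 MB MM] _ _] := mM.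
have [aM|aM] := boolP (a \in M); first exact: MM.
by have := xJ _ (maximal_left_colon mM aM); rewrite inE.
Qed.

(** If [b] were outside a maximal left ideal [M], then [1 = e * b] modulo [M],
    so that [b = b * e * b] modulo [M], which puts [b] back into [M]. *)
Lemma jacobson_semiprime b :
  (forall r, b * r * b \in jacobson_rad R) -> b \in jacobson_rad R.
Proof.
move=> bJ; apply/bigcapP=> M mM; apply: contraT => bM.
have /maximal_left_idealP[lM _ _] := mM.
have /left_idealP[M0 MB MM] := lM.
have [e eM] := maximal_left_comaximal mM bM.
rewrite -(negPf bM) -[b in b \in M](subrK (b * e * b)).
apply: (left_idealD lM).
  by rewrite -mulrA -{1}[b]mulr1 -mulrBr MM.
by have /bigcapP/(_ M mM) := bJ e.
Qed.

(** Right multiplication by [c] is an endomorphism of [R / M] exactly when [c]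
    lies in the idealizer, so [idealizer M] modulo [M] is the opposite ring of
    [End(R / M)]. *)
Definition idealizer M : {set R} := [set c | [forall m in M, m * c \in M]].

Lemma idealizerP M c :
  reflect {in M, forall m, m * c \in M} (c \in idealizer M).
Proof. by rewrite inE; apply: forall_inP. Qed.

(** Schur's lemma for the simple module [R / M]. *)
Lemma idealizer_inv M c :
  maximal_left_ideal M -> c \in idealizer M -> c \notin M ->
  exists2 e, e \in idealizer M & c * e - 1 \in M.
Proof.
move=> mM /idealizerP cI cM.
have /maximal_left_idealP[lM _ maxM] := mM.
have /left_idealP[M0 MB MM] := lM.
have colonE : colon M c = M.
  apply: maxM; first exact: left_ideal_colon.
    by apply/subsetP=> m mMin; rewrite inE cI.
  by rewrite inE mul1r.
have [e eM] := maximal_left_comaximal mM cM; exists e.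
  apply/idealizerP=> m mMin; rewrite -[M]colonE inE -mulrA.
  by rewrite -[e * c](subKr 1) mulrBr mulr1 MB // MM.
rewrite -[M]colonE inE mulrBl mul1r -mulrA -{3}[c]mulr1 -mulrBr MM //.
by rewrite -opprB -sub0r MB.
Qed.

(** Modulo the radical [J], this is [Hom(R / M, R / J)]: a homomorphism is
    determined by the image [b] of the class of [1]. *)
Definition radical_quotient_ann M : {set R} :=
  [set b | [forall m in M, m * b \in jacobson_rad R]].

(** Let [V = R / M], let [D] be the division ring of [idealizer M] modulo [M],
    and let [P] be [radical_quotient_ann M].  An element [b] of [P] defines the [D]-linear functional [w |-> b * w] from [V]
    to [D], and [b] acts as zero only if it lies in [J].  So [P / J] is not
    larger than the [D]-dual of [V], which has the size of [V].  Instead of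
    choosing a basis, the proof enlarges a [D]-subspace [W / M] of [V] one line
    at a time, from [M] to [R], while watching the functionals [PW W] that
    vanish on it: [#|PW W| * #|W|] does not decrease. *)
Lemma leq_card_radical_quotient_ann M :
  maximal_left_ideal M ->
  (#|radical_quotient_ann M| * #|M| <= #|jacobson_rad R| * #|R|)%N.
Proof.
move=> mM; have /maximal_left_idealP[lM M1 maxM] := mM.
have /left_idealP[M0 MB MM] := lM.
have [sM _] := andP lM.
set J := jacobson_rad R; set P := radical_quotient_ann M; set I := idealizer M.
have PP b : reflect {in M, forall m, m * b \in J} (b \in P).
  by rewrite inE; apply: forall_inP.
have /left_idealP[J0 JB JM] := left_ideal_jacobson.
have sJM : J \subset M by apply/bigcap_inf.
have I_gt0 : (0 < #|I|)%N.
  by apply/card_gt0P; exists 1; apply/idealizerP=> m; rewrite mulr1.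
have M_gt0 : (0 < #|M|)%N by apply/card_gt0P; exists 0.
pose PW W := [set b in P | [forall w in W, b * w \in M]].
have PWP W b : reflect (b \in P /\ {in W, forall w, b * w \in M}) (b \in PW W).
  by apply: (iffP setIdP) => -[bP] /forall_inP.
have main k W : (#|R| - #|W| < k)%N -> addsubgroup W -> M \subset W ->
    (forall c, c \in I -> {in W, forall x, x * c \in W}) ->
    (#|PW W| * #|W| <= #|J| * #|R|)%N.
  elim: k W => // k IHk W leWk sW sMW WI.
  have /addsubgroupP[W0 WB] := sW.
  have WD := addsubgroupD sW.
  (* When W is R, a functional b that vanishes on W has M b inside J and b R
     inside M, so b R b is inside J and b is in J by semiprimeness. *)
  have [w /= wW|allW] := pickP [predC W]; last first.
    apply: leq_mul (max_card _); apply/subset_leq_card/subsetP=> b.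
    case/PWP=> /PP bP bW; apply: jacobson_semiprime => r; apply/bP/bW.
    by have /negbFE := allW r.
  pose W' := [set x | [exists c in I, x - w * c \in W]].
  have W'P x : reflect (exists2 c, c \in I & x - w * c \in W) (x \in W').
    by rewrite inE; apply: exists_inP.
  have I0 : 0 \in I by apply/idealizerP=> m _; rewrite mulr0.
  have IB : {in I &, forall c c', c - c' \in I}.
    move=> c c' /idealizerP cI /idealizerP cI'.
    by apply/idealizerP=> m mMin; rewrite mulrBr MB ?cI ?cI'.
  have sWW' : W \subset W'.
    by apply/subsetP=> x xW; apply/W'P; exists 0; rewrite ?mulr0 ?subr0.
  have wW' : w \in W'.
    apply/W'P; exists 1; last by rewrite mulr1 subrr.
    by apply/idealizerP=> m; rewrite mulr1.
  have ltWW' : (#|W| < #|W'|)%N.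
    by apply/proper_card/properP; split=> //; exists w.
  have sW' : addsubgroup W'.
    apply/addsubgroupP; split=> [|x y /W'P[c cI xc] /W'P[c' cI' yc]].
      by apply: (subsetP sWW').
    apply/W'P; exists (c - c'); first exact: IB.
    by rewrite mulrBr opprD addrACA -opprD WB.
  have W'I c : c \in I -> {in W', forall x, x * c \in W'}.
    move=> cI x /W'P[c' cI' xc]; apply/W'P; exists (c' * c).
      move/idealizerP: cI => cI; move/idealizerP: cI' => cI'.
      by apply/idealizerP=> m mMin; rewrite mulrA cI ?cI'.
    by rewrite mulrA -mulrBl WI.
  have IHW' : (#|PW W'| * #|W'| <= #|J| * #|R|)%N.
    apply: IHk => //; last exact: subset_trans sWW'.
    apply: leq_trans (ltn_sub2l _ ltWW') _ => //.
    by apply: leq_trans ltWW' (max_card _).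
  have growW : (#|W| * #|I| <= #|W'| * #|M|)%N.
    rewrite -cardsX.
    apply: (@leq_card_fibers _ _ _ _ _ _ (fun p => p.1 + w * p.2) snd).
    - case=> x c /setXP[/= xW cI]; apply/W'P; exists c => //.
      by rewrite addrK.
    - case=> x c [y c'] /setXP[/= xW cI] /setXP[/= yW cI'] eq_xy.
      have wcW : w * (c - c') \in W.
        rewrite mulrBr (_ : w * c - w * c' = y - x) ?WB //.
        by apply/eqP; rewrite subr_eq addrAC -eq_xy (addrC x) addrK.
      (* Otherwise c - c' is invertible modulo M and w falls into W. *)
      apply: contraT => /(idealizer_inv mM (IB _ _ cI cI'))[e eI inv_e].
      case/negP: wW; rewrite -[w in w \in W](subKr (w * (c - c') * e)).
      apply: WB; first exact: WI.
      apply: (subsetP sMW).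
      by rewrite -mulrA -{2}[w]mulr1 -mulrBr MM.
    - case=> x c [y c'] _ _ /= eq_xy eq_c.
      by move: eq_xy; rewrite eq_c => /addIr->.
  have shrinkP : (#|PW W| * #|M| <= #|I| * #|PW W'|)%N.
    rewrite -cardsX.
    apply: (@leq_card_fibers _ _ _ _ _ _ (fun p => p.1 * w + p.2) fst).
    - case=> b m /setXP[/= /PWP[/PP bP bW] mMin]; apply/idealizerP=> m' m'M.
      rewrite mulrDr mulrA; apply: (left_idealD lM); last exact: MM.
      apply: (subsetP sJM); apply: jacobson_mulr; exact: bP.
    - case=> b m [b' m'] /setXP[/= /PWP[/PP bP bW] mMin].
      case/setXP=> /= /PWP[/PP bP' bW'] mM' eq_b.
      apply/PWP; split.
        by apply/PP=> x xM; rewrite mulrBr JB ?bP ?bP'.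
      have bwM : (b - b') * w \in M.
        rewrite mulrBl (_ : b * w - b' * w = m' - m) ?MB //.
        by apply/eqP; rewrite subr_eq addrAC (addrC m') -eq_b addrK.
      move=> x /W'P[c /idealizerP cI xc].
      rewrite -[x](subrK (w * c)) mulrDr (left_idealD lM) //.
        by rewrite mulrBl MB ?bW ?bW'.
      by rewrite mulrA cI.
    - case=> b m [b' m'] _ _ /= eq_b eq_bb.
      by move: eq_b; rewrite eq_bb => /addrI->.
  have /leq_pmul2r <- : (0 < #|M| * #|I|)%N by rewrite muln_gt0 M_gt0.
  rewrite mulnACA; apply: leq_trans (leq_mul shrinkP growW) _.
  by rewrite (mulnC #|I|) mulnACA (mulnC #|I|) leq_mul.
have -> : P = PW M.
  apply/setP=> b; apply/idP/PWP => [bP|[]//]; split=> // w wM; exact: MM.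
apply: (main #|R|.+1) => //; first by rewrite ltnS leq_subr.
by move=> c /idealizerP.
Qed.

Definition right_ann M : {set R} := [set b | [forall m in M, m * b == 0]].

Lemma right_annP M b :
  reflect {in M, forall m, m * b = 0} (b \in right_ann M).
Proof.
by rewrite inE; apply: (iffP forall_inP) => Mb m mM; apply/eqP/Mb.
Qed.

(** A nonzero [b] killed by [M] generates a quotient of the simple module
    [R / M], hence a minimal left ideal. *)
Lemma right_ann_sub_socle M : maximal_left_ideal M ->
  right_ann M \subset left_socle R.
Proof.
move=> mM; apply/subsetP=> b /right_annP Mb.
have /maximal_left_idealP[lM M1 maxM] := mM.
rewrite inE; apply/existsP.
have [->|b0] := eqVneq b 0.
  exists [ffun=> 0]; apply/andP; split.
    apply/forall_inP=> L /minsetP[/andP[/left_idealP[L0 _ _] _] _].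
    by rewrite ffunE.
  by apply/eqP; rewrite big1 // => L _; rewrite ffunE.
pose L := [set a * b | a : R].
have bL : b \in L by apply/imsetP; exists 1; rewrite ?mul1r.
have minL : minimal_left_ideal L.
  apply/minsetP; split=> [|B /andP[/left_idealP[B0 _ BM] nzB] sBL].
    apply/andP; split.
      apply/left_idealP; split=> [|x y|a x].
      - by apply/imsetP; exists 0; rewrite ?mul0r.
      - move=> /imsetP[a _ ->] /imsetP[a' _ ->].
        by apply/imsetP; exists (a - a'); rewrite ?mulrBl.
      - move=> /imsetP[a' _ ->].
        by apply/imsetP; exists (a * a'); rewrite ?mulrA.
    by apply/eqP=> L0; move: bL; rewrite L0 inE (negPf b0).
  apply/eqP; rewrite eqEsubset sBL; apply/subsetP=> _ /imsetP[a' _ ->].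
  have [x xB x0] : exists2 x, x \in B & x != 0.
    apply/exists_inP; apply: contraR nzB.
    rewrite negb_exists_in => /forall_inP B_0.
    apply/eqP/setP=> x; rewrite inE; apply/idP/eqP => [xB|->//].
    by have := B_0 x xB; rewrite negbK => /eqP.
  have /imsetP[a _ def_x] := subsetP sBL x xB.
  have aM : a \notin M by apply: contraNN x0 => /Mb; rewrite def_x => ->.
  have [e eM] := maximal_left_comaximal mM aM.
  have := Mb _ eM; rewrite mulrBl mul1r => /eqP; rewrite subr_eq0 => /eqP ->.
  by rewrite -mulrA -def_x !BM.
exists [ffun I : {set R} => if I == L then b else 0]; apply/andP; split.
  apply/forall_inP=> I /minsetP[/andP[/left_idealP[I0 _ _] _] _].
  by rewrite ffunE; case: eqP => // ->.
rewrite (bigD1 L) //= ffunE eqxx big1 ?addr0 // => I /andP[_ /negPf].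
by rewrite ffunE => ->.
Qed.

(** The socle isomorphism [phi] turns [M * b = 0] into [M * x] inside [J],
    where [b] is the image of the class of [x]. *)
Lemma leq_card_right_ann M : frobenius R -> maximal_left_ideal M ->
  (#|right_ann M| * #|M| <= #|R|)%N.
Proof.
case=> _ [phi [phi_inj phi_im phiD] phiM] mM.
set J := jacobson_rad R in phi_inj phi_im phiD phiM.
have /left_idealP[J0 JB JM] := left_ideal_jacobson.
have JD := left_idealD left_ideal_jacobson.
have J_gt0 : (0 < #|J|)%N by apply/card_gt0P; exists 0.
have in_quo x : add_coset J x \in add_quotient J by apply/imsetP; exists x.
have phi0 : phi (add_coset J 0) = 0.
  by apply: (addrI (phi (add_coset J 0))); rewrite -phiD !addr0.
have coset0 x : phi (add_coset J x) = 0 -> x \in J.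
  rewrite -phi0 => /(phi_inj _ _ (in_quo _) (in_quo _)) eqJ.
  have : x \in add_coset J x by apply/imsetP; exists 0; rewrite ?addr0.
  by rewrite eqJ => /imsetP[y yJ ->]; rewrite add0r.
pose lift b := odflt 0 [pick x | phi (add_coset J x) == b].
have liftP b : b \in right_ann M -> phi (add_coset J (lift b)) = b.
  move=> bM; have := subsetP (right_ann_sub_socle mM) b bM.
  rewrite -phi_im => /imsetP[_ /imsetP[x _ ->] def_b].
  by rewrite /lift; case: pickP => [y /eqP//|/(_ x)]; rewrite def_b eqxx.
have cardP : (#|right_ann M| * #|J| <= #|radical_quotient_ann M|)%N.
  rewrite -cardsX -(@card_in_imset _ _ (fun p => lift p.1 + p.2)).
    apply/subset_leq_card/subsetP=> _ /imsetP[[b j] /setXP[/= bM jJ] ->].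
    rewrite inE; apply/forall_inP=> m mMin; rewrite mulrDr.
    apply: JD; last exact: JM.
    by apply: coset0; rewrite phiM liftP //; move/right_annP: bM; apply.
  case=> b j [b' j'] /setXP[/= bM jJ] /setXP[/= bM' jJ'] eq_b.
  suff eq_bb : b = b' by move: eq_b; rewrite eq_bb => /addrI->.
  have phij x : x \in J -> phi (add_coset J x) = 0.
    move=> xJ; rewrite -phi0; congr phi; apply/setP=> y.
    apply/imsetP/imsetP=> -[z zJ ->].
      by exists (x + z); rewrite ?add0r ?JD.
    by exists (z - x); rewrite ?JB // add0r addrC subrK.
  by rewrite -(liftP b) // -(liftP b') // -[LHS]addr0 -[RHS]addr0
     -{1}(phij j) // -(phij j') // -!phiD eq_b.
rewrite -(leq_pmul2r J_gt0) mulnAC [(#|R| * _)%N]mulnC.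
apply: leq_trans (leq_card_radical_quotient_ann mM).
by rewrite leq_mul2r cardP orbT.
Qed.

End RingIdeals.

(** * Sizes of dual codes *)

Section CodeDuality.
Variables (R : finPzRingType) (n : nat).
Implicit Types (C D : {set 'rV[R]_n}) (u v w : 'rV[R]_n) (L M : {set R}).

Lemma dotv_linearl a u v w : dotv (a *: u + v) w = a * dotv u w + dotv v w.
Proof.
rewrite /dotv mulr_sumr -big_split; apply: eq_bigr => i _ /=.
by rewrite !mxE mulrDl mulrA.
Qed.

Lemma dotvBr u v w : dotv u (v - w) = dotv u v - dotv u w.
Proof.
rewrite /dotv -sumrB; apply: eq_bigr => i _ /=.
by rewrite !mxE mulrBr.
Qed.

Lemma dotv0l u : dotv 0 u = 0.
Proof. by rewrite /dotv big1 // => i _; rewrite mxE mul0r. Qed.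

Lemma dotv_delta i u : dotv (delta_mx 0 i) u = u 0 i.
Proof.
rewrite /dotv (bigD1 i) //= mxE !eqxx mul1r big1 ?addr0 // => j /negPf ji.
by rewrite mxE eqxx ji mul0r.
Qed.

Lemma right_dualP C u :
  reflect {in C, forall v, dotv v u = 0} (u \in right_dual C).
Proof.
by rewrite inE; apply: (iffP forall_inP) => Cu v vC; apply/eqP/Cu.
Qed.

Section LinearCode.
Variables (C : {set 'rV[R]_n}) (linC : left_linear_code C).

Lemma code0 : 0 \in C. Proof. by case: linC. Qed.

Lemma codeZ a : {in C, forall u, a *: u \in C}.
Proof. by case: linC => C0 CP u uC; rewrite -[_ *: u]addr0 CP. Qed.

Lemma codeD : {in C &, forall u v, u + v \in C}.
Proof. by case: linC => _ CP u v uC vC; rewrite -[u]scale1r CP. Qed.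

Lemma codeB : {in C &, forall u v, u - v \in C}.
Proof. by move=> u v uC vC; rewrite codeD // -scaleN1r codeZ. Qed.

Lemma code_gt0 : (0 < #|C|)%N.
Proof. by apply/card_gt0P; exists 0; apply: code0. Qed.

End LinearCode.

(** The code [C + L v]; for [L] the whole ring this adds the generator [v]. *)
Definition adjoin C v L := [set x | [exists r in L, x - r *: v \in C]].

Lemma adjoinP C v L x :
  reflect (exists2 r, r \in L & x - r *: v \in C) (x \in adjoin C v L).
Proof. by rewrite inE; apply: exists_inP. Qed.

Lemma adjoin_linear C v L :
  left_linear_code C -> left_ideal L -> left_linear_code (adjoin C v L).
Proof.
move=> linC lL; have /left_idealP[L0 LB LM] := lL.
split=> [|a x y /adjoinP[r rL xC] /adjoinP[s sL yC]]; apply/adjoinP.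
  by exists 0; rewrite // scale0r subr0 code0.
exists (a * r + s); first by apply: (left_idealD lL); rewrite ?LM.
by rewrite scalerDl opprD addrACA -scalerA -scalerBr codeD ?codeZ.
Qed.

Lemma adjoin_sub C D v L : left_linear_code D ->
  C \subset D -> v \in D -> adjoin C v L \subset D.
Proof.
move=> linD sCD vD; apply/subsetP=> x /adjoinP[r _ xC].
by rewrite -[x](subrK (r *: v)) codeD ?codeZ // (subsetP sCD).
Qed.

Definition linear_codeb C : bool :=
  (0 \in C) && [forall a, forall u in C, forall v in C, a *: u + v \in C].

Lemma linear_codeP C : reflect (left_linear_code C) (linear_codeb C).
Proof.
apply: (iffP andP) => -[C0 CP]; split=> //.
  move=> a u v uC vC; move/forallP: CP => /(_ a)/forall_inP/(_ u uC).
  by move/forall_inP; apply.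
apply/forallP=> a; apply/forall_inP=> u uC; apply/forall_inP=> v vC.
exact: CP.
Qed.

(** Take [v] in a minimal code [D] strictly above [C] inside [C'], so that
    [D / C] is simple and generated by [v]; then [M] is the annihilator of [v]
    modulo [C]. *)
Lemma minimal_overcode C C' : left_linear_code C -> left_linear_code C' ->
    C \proper C' ->
  exists v M, [/\ maximal_left_ideal M, v \notin C, v \in C',
     forall r, (r *: v \in C) = (r \in M)
   & C \proper adjoin C v [set: R]].
Proof.
move=> linC linC' ltCC'.
have PC' : linear_codeb C' && (C \proper C').
  by rewrite ltCC' andbT; apply/linear_codeP.
have [D minD sDC'] :=
  minset_exists (P := fun D => linear_codeb D && (C \proper D)) PC'.
have /minsetP[/andP[/linear_codeP linD ltCD] min_eq] := minD.
have /properP[sCD [v vD vC]] := ltCD.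
have colonE r : (r *: v \in C) = (r \in [set s | s *: v \in C]) by rewrite inE.
exists v, [set s | s *: v \in C]; split=> //.
- apply/maximal_left_idealP; split=> [||L lL sML L1].
  + apply/left_idealP; split=> [|x y|a x]; rewrite ?inE.
    * by rewrite scale0r code0.
    * by rewrite scalerBl; apply: codeB.
    * by move=> xC; rewrite -scalerA codeZ.
  + by rewrite inE scale1r.
  have /left_idealP[L0 _ _] := lL.
  apply/eqP; rewrite eqEsubset sML andbT; apply/subsetP=> r rL; rewrite inE.
  have rvL : r *: v \in adjoin C v L.
    by apply/adjoinP; exists r; rewrite ?subrr ?code0.
  apply: contraT => rvC.
  have sCL : C \proper adjoin C v L.
    apply/properP; split; last by exists (r *: v).
    by apply/subsetP=> x xC; apply/adjoinP; exists 0; rewrite ?scale0r ?subr0.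
  have eqD : adjoin C v L = D.
    apply: min_eq; last exact: adjoin_sub.
    by rewrite sCL andbT; apply/linear_codeP/adjoin_linear.
  move: vD; rewrite -eqD => /adjoinP[s sL]; rewrite -{1}[v]scale1r -scalerBl.
  rewrite colonE => /(subsetP sML) s1; case/negP: L1.
  by rewrite -[1](subrK s); apply: (left_idealD lL).
- exact: (subsetP sDC').
apply/properP; split.
  apply/subsetP=> x xC; apply/adjoinP.
  by exists 0; rewrite ?inE ?scale0r ?subr0.
exists v => //; apply/adjoinP; exists 1; rewrite ?inE //.
by rewrite scale1r subrr code0.
Qed.

(** Writing [D] for the enlarged code, [D / C] is isomorphic to [R / M], and
    [u |-> dotv v u] embeds [right_dual C] modulo [right_dual D] into the right
    annihilator of [M]. *)
Lemma leq_card_code_dual_adjoin C v M : frobenius R -> left_linear_code C ->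
    maximal_left_ideal M -> (forall r, (r *: v \in C) = (r \in M)) ->
  (#|C| * #|right_dual C| <=
    #|adjoin C v [set: R]| * #|right_dual (adjoin C v [set: R])|)%N.
Proof.
move=> frobR linC mM colonE; set D := adjoin C v _.
have cardD : (#|C| * #|R| <= #|D| * #|M|)%N.
  rewrite -[#|R|]cardsT -cardsX.
  apply: (@leq_card_fibers _ _ _ _ _ _ (fun p => p.1 + p.2 *: v) snd).
  - case=> c r /setXP[/= cC _]; apply/adjoinP; exists r; rewrite ?inE //.
    by rewrite addrK.
  - case=> c r [c' r'] /setXP[/= cC _] /setXP[/= cC' _] eq_c.
    rewrite -colonE scalerBl (_ : _ - _ = c' - c) ?codeB //.
    by apply/eqP; rewrite subr_eq addrAC -eq_c (addrC c) addrK.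
  - case=> c r [c' r'] _ _ /= eq_c eq_r.
    by move: eq_c; rewrite eq_r => /addIr->.
have card_dual : (#|right_dual C| <= #|right_ann M| * #|right_dual D|)%N.
  apply: (@leq_card_fibers _ _ _ _ _ _ (dotv v) id) => //.
  - move=> u /right_dualP Cu; apply/right_annP=> m mM'.
    have := Cu (m *: v); rewrite colonE => /(_ mM') <-.
    by rewrite -[m *: v]addr0 dotv_linearl dotv0l addr0.
  - move=> u u' /right_dualP Cu /right_dualP Cu' eq_u.
    apply/right_dualP=> x /adjoinP[r _ xC].
    rewrite -[x](subrK (r *: v)) addrC dotv_linearl !dotvBr eq_u subrr mulr0.
    by rewrite Cu ?Cu' // subrr addr0.
have R_gt0 : (0 < #|R|)%N by apply/card_gt0P; exists 0.
rewrite -(leq_pmul2r R_gt0) mulnAC.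
apply: leq_trans (leq_mul cardD card_dual) _.
rewrite (mulnC #|right_ann M|) mulnACA (mulnC #|M|).
by rewrite leq_mul2l leq_card_right_ann ?orbT.
Qed.

Lemma leq_card_code_dual C C' : frobenius R ->
    left_linear_code C -> left_linear_code C' -> C \subset C' ->
  (#|C| * #|right_dual C| <= #|C'| * #|right_dual C'|)%N.
Proof.
move=> frobR linC linC'.
have [k] := ubnP (#|C'| - #|C|)%N; elim: k C linC => // k IHk C linC leCk sCC'.
have [->|neqC] := eqVneq C C'; first by [].
have ltCC' : C \proper C' by rewrite properEneq neqC.
have [v [M [mM vC vC' colonE ltCD]]] := minimal_overcode linC linC' ltCC'.
have sDC' : adjoin C v [set: R] \subset C' by apply: adjoin_sub.
apply: leq_trans (leq_card_code_dual_adjoin frobR linC mM colonE) _.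
apply: IHk => //.
  apply: adjoin_linear => //; apply/left_idealP.
  by split=> [|x y _ _|a x _]; rewrite inE.
apply: leq_trans (_ : (#|C'| - #|C|) <= k)%N => //.
by rewrite ltn_sub2l ?proper_card.
Qed.

(** The product on the left is monotone in the code and equals [#|R| ^ n] both
    at the zero code and at the full space, so it is constant. *)
Theorem card_code_dual C : frobenius R -> left_linear_code C ->
  (#|C| * #|right_dual C| = #|R| ^ n)%N.
Proof.
move=> frobR linC.
have cardV : #|{: 'rV[R]_n}| = (#|R| ^ n)%N by rewrite card_mx mul1n.
have lin0 : left_linear_code [set (0 : 'rV[R]_n)].
  by split=> [|a u v]; rewrite !inE // => /eqP-> /eqP->; rewrite scaler0 addr0.
have linT : left_linear_code [set: 'rV[R]_n].
  by split=> [|a u v _ _]; apply: in_setT.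
have dual0 : right_dual [set (0 : 'rV[R]_n)] = [set: 'rV[R]_n].
  apply/setP=> u; rewrite [RHS]inE.
  by apply/right_dualP=> v /set1P->; apply: dotv0l.
have dualT : right_dual [set: 'rV[R]_n] = [set 0].
  apply/setP=> u; rewrite [RHS]inE; apply/right_dualP/eqP=> [uT|-> v _].
    by apply/rowP=> i; rewrite [RHS]mxE -(uT (delta_mx 0 i)) ?inE ?dotv_delta.
  by rewrite /dotv big1 // => i _; rewrite mxE mulr0.
apply/eqP; rewrite eqn_leq; apply/andP; split.
  have := leq_card_code_dual frobR linC linT (subsetT _).
  by rewrite dualT cards1 muln1 cardsT cardV.
have := leq_card_code_dual frobR lin0 linC.
rewrite dual0 cards1 mul1n cardsT cardV; apply.
by apply/subsetP=> u /set1P->; case: linC.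
Qed.

Definition subcode C (X : {set 'I_n}) := [set u in C | supp u \subset X].

Lemma supp_subP u (X : {set 'I_n}) :
  reflect (forall i, i \notin X -> u 0 i = 0) (supp u \subset X).
Proof.
apply: (iffP subsetP) => uX i.
  by move=> iX; apply/eqP; apply: contraNT iX => ui; apply: uX; rewrite inE.
by rewrite inE; apply: contraNT => /uX->.
Qed.

Lemma card_supp_sub (X : {set 'I_n}) :
  #|[set u : 'rV[R]_n | supp u \subset X]| = (#|R| ^ #|X|)%N.
Proof.
rewrite -[in RHS](cardsT R) -(card_pffun_on 0 (mem X)) -[RHS]cardsE.
pose h (u : 'rV[R]_n) := [ffun i => u 0 i].
have h_inj : injective h.
  by move=> u v /ffunP huv; apply/rowP=> i; have := huv i; rewrite !ffunE.
rewrite -(card_imset _ h_inj); congr #|pred_of_set _|; apply/setP=> g.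
rewrite [RHS]inE; apply/imsetP/pffun_onP => [[u uX ->]|[gX _]].
  rewrite inE in uX; split=> [|y _]; last exact: in_setT.
  apply/subsetP=> i; rewrite inE ffunE => ui.
  by apply: (subsetP uX); rewrite inE.
exists (\row_i g i); last by apply/ffunP=> i; rewrite ffunE mxE.
rewrite inE; apply/subsetP=> i; rewrite inE mxE => gi.
by apply: (subsetP gX).
Qed.

(** Apply [card_code_dual] to the code [S] of the words that agree on [X] with a
    word of [C]: it is the sum of [C] and of all the words supported off [X],
    and its dual is [subcode (right_dual C) X]. *)
Theorem card_subcode_dual C X : frobenius R -> left_linear_code C ->
  (#|subcode (right_dual C) X| * #|C| = #|R| ^ #|X| * #|subcode C (~: X)|)%N.
Proof.
move=> frobR linC; set Y := ~: X.
pose F := [set u : 'rV[R]_n | supp u \subset Y].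
have FP u : reflect (forall i, i \in X -> u 0 i = 0) (u \in F).
  rewrite inE; apply: (iffP (supp_subP _ _)) => uY i; have := uY i;
  by rewrite inE ?negbK.
have FB : {in F &, forall u v, u - v \in F}.
  by move=> u v /FP uF /FP vF; apply/FP=> i iX; rewrite !mxE uF ?vF ?subrr.
pose S := [set x | [exists c in C, x - c \in F]].
have SP x : reflect (exists2 c, c \in C & x - c \in F) (x \in S).
  by rewrite inE; apply: exists_inP.
have linS : left_linear_code S.
  split=> [|a x y /SP[c cC /FP xc] /SP[c' cC' /FP yc]]; apply/SP.
    exists 0; first exact: code0.
    by apply/FP=> i _; rewrite subrr mxE.
  exists (a *: c + c'); first by rewrite codeD ?codeZ.
  apply/FP=> i iX; rewrite opprD addrACA -scalerBr mxE yc // addr0.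
  by rewrite mxE xc ?mulr0.
have dualS : right_dual S = subcode (right_dual C) X.
  apply/setP=> u; rewrite [RHS]inE; apply/right_dualP/andP => [Su|].
    split.
      apply/right_dualP=> c cC; apply: Su; apply/SP; exists c => //.
      by apply/FP=> i _; rewrite subrr mxE.
    apply/supp_subP=> i iX; rewrite -(Su (delta_mx 0 i)) ?dotv_delta //.
    apply/SP; exists 0; first exact: code0.
    apply/FP=> j jX; rewrite subr0 mxE eqxx /=.
    by case: eqP jX iX => // -> ->.
  case=> /right_dualP Cu /supp_subP uX x /SP[c cC /FP xc].
  rewrite -(Cu c cC); apply: eq_bigr => i _; have [iX|/uX->] := boolP (i \in X).
    by have := xc i iX; rewrite !mxE => /eqP; rewrite subr_eq0 => /eqP->.
  by rewrite !mulr0.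
have cardS : (#|S| * #|subcode C Y| = #|C| * #|F|)%N.
  apply/eqP; rewrite eqn_leq -!cardsX; apply/andP; split.
    pose rep x := odflt 0 [pick c in C | x - c \in F].
    have repP x : x \in S -> rep x \in C /\ x - rep x \in F.
      move=> /SP[c cC xc]; rewrite /rep; case: pickP => [c' /andP[]//|/(_ c)].
      by rewrite cC xc.
    (* (x, k) |-> (r + k, x - r - k) with r + (x - r) a decomposition of x. *)
    rewrite -(@card_in_imset _ _
      (fun p => (rep p.1 + p.2, p.1 - rep p.1 - p.2))).
      apply/subset_leq_card/subsetP=> p /imsetP[[x k] /setXP[/= xS kCY] ->{p}].
      move: kCY; rewrite inE => /andP[kC kY]; have [rC rF] := repP x xS.
      by rewrite in_setX /= codeD // FB // inE.
    case=> x k [x' k'] _ _ /= [eq_c eq_w].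
    have eq_x : x = x'.
      have sumK (a b c : 'rV[R]_n) : a + b + (c - a - b) = c.
        by rewrite -(addrA c) -opprD addrCA subrr addr0.
      by rewrite -(sumK (rep x) k x) eq_c eq_w sumK.
    by move: eq_c; rewrite eq_x => /addrI->.
  rewrite !cardsX -cardsX.
  apply: (@leq_card_fibers _ _ _ _ _ _ (fun p => p.1 + p.2) fst).
  - case=> c w /setXP[/= cC wF]; apply/SP; exists c => //.
    by rewrite addrC addKr.
  - case=> c w [c' w'] /setXP[/= cC wF] /setXP[/= cC' wF'] eq_c.
    rewrite inE codeB //= (_ : c - c' = w' - w).
      by have := FB _ _ wF' wF; rewrite inE.
    by apply/eqP; rewrite subr_eq addrAC (addrC w') -eq_c addrK.
  - case=> c w [c' w'] _ _ /= eq_c eq_cc.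
    by move: eq_c; rewrite eq_cc => /addrI->.
have cardF : #|F| = (#|R| ^ #|Y|)%N by apply: card_supp_sub.
have := card_code_dual frobR linS; rewrite dualS => cardSd.
have R_gt0 : (0 < #|R|)%N by apply/card_gt0P; exists 0.
apply/eqP; rewrite -(eqn_pmul2l (code_gt0 linS)).
rewrite -(@eqn_pmul2r (#|R| ^ #|Y|)) ?expn_gt0 ?R_gt0 //; apply/eqP.
have cardV : (#|R| ^ n = #|R| ^ #|X| * #|R| ^ #|Y|)%N.
  by rewrite -expnD cardsC card_ord.
rewrite mulnA cardSd -mulnA -cardF -cardS cardF cardV.
by rewrite [in RHS]mulnCA [RHS]mulnAC.
Qed.

End CodeDuality.

(** * Sums over subsets *)

Section SubsetSums.
Variables (n : nat) (L : comNzRingType).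
Implicit Types (X Y Z T : {set 'I_n}) (a b c : L).

Lemma prod_addc Z (g : 'I_n -> L) c :
  \prod_(i in Z) (g i + c) =
  \sum_(Y : {set 'I_n} | Y \subset Z) c ^+ (#|Z| - #|Y|) * \prod_(i in Y) g i.
Proof.
transitivity
  (\prod_i ((if i \in Z then g i else 0) + (if i \in Z then c else 1))).
  by rewrite big_mkcond; apply: eq_bigr => i _; case: ifP; rewrite ?add0r.
rewrite bigA_distr [RHS]big_mkcond; apply: eq_bigr => Y _.
have [/subsetP sYZ|/subsetPn[i iY iZ]] := boolP (Y \subset Z); last first.
  by rewrite (bigD1 i) //= iY (negPf iZ) mul0r.
have -> : (#|Z| - #|Y| = #|Z :\: Y|)%N.
  by rewrite cardsD (setIidPr _) //; apply/subsetP.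
rewrite -prodr_const [X in _ = X * _]big_mkcond [X in _ = _ * X]big_mkcond.
rewrite -big_split; apply: eq_bigr => i _ /=; rewrite inE.
by have [/sYZ-> | _] := boolP (i \in Y); rewrite ?mul1r ?mulr1.
Qed.

Lemma sum_supersets T a b :
  \sum_(X : {set 'I_n} | T \subset X) a ^+ #|~: X| * b ^+ #|X| =
  b ^+ #|T| * (a + b) ^+ #|~: T|.
Proof.
rewrite -!prodr_const [X in _ = X * _]big_mkcond [X in _ = _ * X]big_mkcond.
rewrite -big_split /=.
transitivity (\prod_(i < n) (b + (if i \in T then 0 else a))).
  rewrite bigA_distr big_mkcond; apply: eq_bigr => X _.
  have [/subsetP sTX|/subsetPn[i iT iX]] := boolP (T \subset X); last first.
    by rewrite (bigD1 i) //= (negPf iX) iT mul0r.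
  rewrite -!prodr_const [X in X * _ = _]big_mkcond [X in _ * X = _]big_mkcond.
  rewrite -big_split; apply: eq_bigr => i _ /=; rewrite inE.
  have [_|iX] := boolP (i \in X); rewrite ?mul1r ?mulr1 //.
  by rewrite ifN //; apply: contraNN iX => /sTX.
apply: eq_bigr => i _; rewrite inE.
by case: (i \in T); rewrite ?addr0 ?mulr1 ?mul1r // addrC.
Qed.

End SubsetSums.

(** * Harmonic functions *)

Section HarmonicSums.
Variables (K : realType) (n d : nat) (f : RE K n d).
Hypothesis harmf : harmonic f.
Implicit Types (X Y : {set 'I_n}).

(** For sets of size [d - 1] this is harmonicity, coordinate by coordinate.  For
    smaller [Y], summing the statement for [i |: Y] over all [i] outside [Y]
    counts each superset of [Y] exactly [d - #|Y|] times. *)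
Lemma harmonic_sum_supersets Y : (#|Y| < d)%N ->
  \sum_(Z : dsubset n d | Y \subset val Z) f Z = 0 :> K.
Proof.
have [k] := ubnP (d - #|Y|)%N; elim: k Y => // k IHk Y ltdk ltYd.
have d_gt0 : (0 < d)%N by apply: leq_ltn_trans ltYd.
have [eqY|neqY] := eqVneq #|Y| d.-1.
  pose Y' : dsubset n d.-1 := exist _ Y (introT eqP eqY).
  have := congr1 (fun h : RE K n d.-1 => h Y') harmf.
  rewrite /gamma sum_ffunE ffunE => h; rewrite -[RHS]h big_mkcond.
  apply: eq_bigr => Z _; rewrite ffunE /gamma_basis gtn_eqF // sum_ffunE.
  rewrite (eq_bigr (fun V : dsubset n d.-1 => (V == Y')%:R)); last first.
    by move=> V _; rewrite ffunE eq_sym.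
  case: ifP => sYZ.
    rewrite (bigD1 Y') //= eqxx big1 => [|V /andP[_ /negPf->//]].
    by rewrite addr0 [RHS]mulr1.
  rewrite big1 ?scaler0 // => V sVZ; case: eqP => // eqV.
  by move: sVZ; rewrite eqV /= sYZ.
have ltY1 : (#|Y|.+1 < d)%N.
  by rewrite -[d in (_ < d)%N]prednK // ltnS ltn_neqAle neqY -ltnS prednK.
have dY0 : (d - #|Y|)%:R != 0 :> K.
  by rewrite Num.Theory.pnatr_eq0 subn_eq0 -ltnNge.
apply: (mulfI dY0); rewrite mulr0.
transitivity (\sum_(i in ~: Y)
    \sum_(Z : dsubset n d | i |: Y \subset val Z) (f Z : K)).
  rewrite (exchange_big_dep (fun Z : dsubset n d => Y \subset val Z)) /=;
    last first.
    by move=> i Z _; apply: subset_trans; apply: subsetUr.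
  rewrite mulr_sumr; apply: eq_bigr => Z sYZ.
  rewrite sumr_const mulr_natl; congr (_ *+ _).
  have -> : (d - #|Y| = #|val Z :\: Y|)%N.
    by rewrite cardsD (setIidPr _) // (eqP (valP Z)).
  apply: eq_card => i; rewrite inE [RHS]unfold_in /=.
  by rewrite inE subUset sub1set sYZ andbT.
apply: big1 => i; rewrite inE => iY; apply: IHk; rewrite cardsU1 iY add1n //.
by rewrite -ltnS (leq_trans _ ltdk) // subnSK.
Qed.

Variable L : comAlgType K.

Definition harmonic_eval (g : 'I_n -> L) : L :=
  \sum_(Z : dsubset n d) f Z *: \prod_(i in val Z) g i.

(** Expanding the product over [Z], the term of a proper subset [Y] of [Z] has a
    coefficient that only depends on [Y]; collecting these terms, each [Y] gets
    the sum of [f] over its supersets, which is zero. *)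
Lemma harmonic_eval_addc (g : 'I_n -> L) c :
  harmonic_eval (fun i => g i + c) = harmonic_eval g.
Proof.
rewrite /harmonic_eval.
transitivity (\sum_(Z : dsubset n d) f Z *: \prod_(i in val Z) g i +
  \sum_(Z : dsubset n d) \sum_(Y : {set 'I_n} | Y \proper val Z)
     f Z *: (c ^+ (d - #|Y|) * \prod_(i in Y) g i)).
  rewrite -big_split; apply: eq_bigr => Z _ /=.
  rewrite prod_addc (bigD1 (val Z)) //= subnn expr0 mul1r scalerDr scaler_sumr.
  congr (_ + _); apply: eq_big => [Y|Y _]; last by rewrite (eqP (valP Z)).
  by rewrite properEneq andbC.
rewrite [X in _ + X](exchange_big_dep predT) //=.
rewrite [X in _ + X]big1 ?addr0 // => Y _.
rewrite -scaler_suml.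
have [ltYd|leYd] := ltnP #|Y| d.
  rewrite (eq_bigl (fun Z : dsubset n d => Y \subset val Z)).
    by rewrite harmonic_sum_supersets ?scale0r.
  move=> Z; rewrite properEcard (eqP (valP Z)) ltYd andbT //.
rewrite [X in X *: _]big_pred0 ?scale0r // => Z.
by rewrite properEcard (eqP (valP Z)) [(_ < d)%N]ltnNge leYd andbF.
Qed.

(** Subtracting [t] leaves [s - t] on [X] and [0] off [X], so only the sets [Z]
    inside [X] contribute. *)
Lemma harmonic_eval_two_values X (s t : L) :
  harmonic_eval (fun i => if i \in X then s else t) =
  ftilde f X *: (s - t) ^+ d.
Proof.
rewrite -(harmonic_eval_addc _ (- t)) /harmonic_eval /ftilde scaler_suml.
rewrite [RHS]big_mkcond; apply: eq_bigr => Z _.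
have [/subsetP sZX|/subsetPn[i iZ iX]] := boolP (val Z \subset X); last first.
  by rewrite (bigD1 i) //= (negPf iX) subrr mul0r scaler0.
rewrite (eq_bigr (fun=> s - t)) => [|i /sZX->//].
by rewrite prodr_const (eqP (valP Z)).
Qed.

Lemma ftilde_small X : (#|X| < d)%N -> ftilde f X = 0.
Proof.
move=> ltXd; rewrite /ftilde big_pred0 // => Z; apply/negP=> /subset_leq_card.
by rewrite leqNgt (eqP (valP Z)) ltXd.
Qed.

End HarmonicSums.

(** * Enumerators weighted by a harmonic function *)

Section Duality.
Variables (K : realType) (n d : nat) (f : RE K n d).
Hypothesis harmf : harmonic f.
Implicit Types (X Y : {set 'I_n}) (alpha : {set 'I_n} -> K).

(** Evaluate the form at the indicator function of the complement of [X]. *)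
Lemma ftildeC X : ftilde f (~: X) = (-1) ^+ d * ftilde f X.
Proof.
transitivity (harmonic_eval f (fun i => if i \in X then 0 else 1 : K^o)).
  rewrite /ftilde big_mkcond; apply: eq_bigr => Z _.
  have [/subsetP sZX|/subsetPn[i iZ]] := boolP (val Z \subset ~: X); last first.
    by rewrite inE negbK => iX; rewrite (bigD1 i) //= iX mul0r scaler0.
  by rewrite big1 ?[RHS]mulr1 // => i /sZX; rewrite inE => /negPf->.
by rewrite harmonic_eval_two_values // sub0r [LHS]mulrC.
Qed.

Lemma ftilde_large X : (#|~: X| < d)%N -> ftilde f X = 0.
Proof.
by move=> ltXd; rewrite -[X]setCK ftildeC ftilde_small ?mulr0.
Qed.

Variable L : comAlgType K.
Implicit Types (a b : L).

Definition weighted_enum alpha a b : L :=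
  \sum_(X : {set 'I_n}) (ftilde f X * alpha X) *: (a ^+ #|~: X| * b ^+ #|X|).

(** The quotient of [weighted_enum] by [(a * b) ^+ d].  The truncated
    subtractions are harmless for a harmonic [f], as [ftilde f X] is then zero
    when [X] or its complement has fewer than [d] elements. *)
Definition reduced_enum alpha a b : L :=
  \sum_(X : {set 'I_n})
    (ftilde f X * alpha X) *: (a ^+ (#|~: X| - d) * b ^+ (#|X| - d)).

Lemma weighted_enumE alpha a b :
  weighted_enum alpha a b = (a * b) ^+ d * reduced_enum alpha a b.
Proof.
rewrite /weighted_enum mulr_sumr; apply: eq_bigr => X _.
have [ltXd|leXd] := ltnP #|X| d.
  by rewrite ftilde_small // mul0r !scale0r mulr0.
have [ltXd|leXdC] := ltnP #|~: X| d.
  by rewrite ftilde_large // mul0r !scale0r mulr0.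
by rewrite -scalerAr exprMn mulrACA -!exprD !subnKC.
Qed.

(** Summing first over [X], the set [Z] contributes [b ^+ #|U|] times
    [(a + b) ^+ #|~: U|], where [U] is the union of [Y] and [Z].  Up to a factor
    that depends only on [#|Y|], this is the product over [Z] of the function
    equal to [a + b] on [Y] and to [b] off [Y], whose two values differ by
    [a]. *)
Lemma sum_ftilde_supersets Y a b :
  \sum_(X : {set 'I_n} | Y \subset X)
     ftilde f X *: (a ^+ #|~: X| * b ^+ #|X|) =
  ftilde f Y *: (a ^+ d * (b ^+ #|Y| * (a + b) ^+ (#|~: Y| - d))).
Proof.
have [ltYd|leYd] := ltnP #|~: Y| d.
  rewrite ftilde_large // scale0r big1 // => X sYX.
  rewrite ftilde_large ?scale0r // (leq_ltn_trans _ ltYd) //.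
  by rewrite subset_leq_card // setCS.
(* The factor a ^+ d arises as (a + b - b) ^+ d. *)
rewrite -{2}[a](addrK b) scalerAl -harmonic_eval_two_values // mulr_suml.
under eq_bigr do rewrite scaler_suml.
rewrite (exchange_big_dep predT) //=; apply: eq_bigr => Z _.
rewrite -scaler_sumr -scalerAl; congr (_ *: _).
rewrite (eq_bigl (fun X => Y :|: val Z \subset X)); last first.
  by move=> X; rewrite subUset.
rewrite sum_supersets.
rewrite (big_setID Y) /=.
rewrite (eq_bigr (fun=> a + b)); last by move=> i /setIP[_ ->].
rewrite [X in _ = _ * X * _](eq_bigr (fun=> b)); last first.
  by move=> i /setDP[_ /negPf->].
rewrite !prodr_const.
have cardU : (#|Y :|: val Z| = #|val Z :\: Y| + #|Y|)%N.
  by rewrite setUC cardsU cardsD addnBAC ?subset_leq_card ?subsetIl.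
have cardC : (#|~: (Y :|: val Z)| = #|val Z :&: Y| + (#|~: Y| - d))%N.
  rewrite setCU -setDE cardsD setIC -setDE cardsD (eqP (valP Z)).
  rewrite subnBA ?addnBA ?[in RHS](addnC _ #|~: Y|) 1?addnC //.
  by rewrite -[leqRHS](eqP (valP Z)) subset_leq_card ?subsetIl.
rewrite cardU cardC !exprD !mulrA; congr (_ * _).
by rewrite -[RHS]mulrA [RHS]mulrC.
Qed.

Lemma weighted_enum_down_sums alpha beta a b :
  (forall X, beta X = \sum_(Y : {set 'I_n} | Y \subset X) alpha Y) ->
  weighted_enum beta a b = (a * b) ^+ d * reduced_enum alpha (a + b) b.
Proof.
move=> betaE; rewrite /weighted_enum.
under eq_bigr do rewrite betaE mulr_sumr scaler_suml.
rewrite (exchange_big_dep predT) //= mulr_sumr; apply: eq_bigr => Y _.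
under eq_bigr do rewrite mulrC -scalerA.
rewrite -scaler_sumr sum_ftilde_supersets scalerA [alpha Y * _]mulrC.
have [ltYd|leYd] := ltnP #|Y| d.
  by rewrite ftilde_small // mul0r !scale0r mulr0.
rewrite -scalerAr; congr (_ *: _).
rewrite -[in LHS](subnKC leYd) exprD exprMn -!mulrA.
by congr (_ * (_ * _)); apply: mulrC.
Qed.

(** Complementing [X] exchanges the exponents of [a] and [b] and costs the sign
    [(-1) ^+ d] in [ftilde]. *)
Lemma weighted_enum_setC beta gamma (c q : K) a b :
  (forall X, gamma X = c * (q ^+ #|X| * beta (~: X))) ->
  weighted_enum gamma a b =
  ((-1) ^+ d * c) *: weighted_enum beta (q *: b) a.
Proof.
move=> gammaE; rewrite /weighted_enum scaler_sumr (reindex_inj (@setC_inj _)) /=.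
apply: eq_bigr => X _.
rewrite gammaE ftildeC !setCK exprZn -scalerAl !scalerA [a ^+ _ * _]mulrC.
congr (_ *: _); rewrite -!mulrA; congr (_ * _).
by rewrite mulrCA [beta _ * _]mulrC.
Qed.

(** The general shape of the duality: [beta] and [beta'] stand for the
    numbers of [m]-tuples of words supported inside a given set, for a code and
    for its dual, and [alpha] and [alpha'] for the numbers of those whose joint
    support is exactly that set. *)
Lemma reduced_enum_duality alpha beta alpha' beta' (c q : K) a b :
  (forall X, beta X = \sum_(Y : {set 'I_n} | Y \subset X) alpha Y) ->
  (forall X, beta' X = \sum_(Y : {set 'I_n} | Y \subset X) alpha' Y) ->
  (forall X, beta' X = c * (q ^+ #|X| * beta (~: X))) ->
  (a * b) ^+ d * reduced_enum alpha' (a + b) b =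
  (a * b) ^+ d *
    (((-1) ^+ d * (q ^+ d * c)) *: reduced_enum alpha (a + q *: b) a).
Proof.
move=> betaE betaE' dualE.
rewrite -(weighted_enum_down_sums _ _ betaE') (weighted_enum_setC _ _ dualE).
rewrite (weighted_enum_down_sums _ _ betaE) -scalerAl exprZn -scalerAl scalerA.
rewrite [q *: b + a]addrC [b * a]mulrC -scalerAr mulrAC mulrA; congr (_ *: _).
Qed.

End Duality.

(** * The duality for codes *)

Lemma sum_supp_count (R : finPzRingType) n m (C : {set 'rV[R]_n})
    (X : {set 'I_n}) :
  (\sum_(Y : {set 'I_n} | Y \subset X) supp_count m C Y = #|subcode C X| ^ m)%N.
Proof.
pose union_supp (u : {ffun 'I_m -> 'rV[R]_n}) := \bigcup_i supp (u i).
transitivity #|[set u : {ffun 'I_m -> 'rV[R]_n} |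
  [forall i, u i \in C] && (union_supp u \subset X)]|.
  rewrite -sum1_card (partition_big union_supp (fun Y => Y \subset X)) => [|u].
    apply: eq_bigr => Y sYX; rewrite /supp_count sum1_card.
    apply: eq_card => u; rewrite inE [RHS]unfold_in /= inE -andbA.
    congr (_ && _).
    by rewrite -/(union_supp u); case: eqP => [->|]; rewrite ?sYX ?andbF.
  by rewrite inE => /andP[].
rewrite -[in RHS](card_ord m) -card_ffun_on; apply: eq_card => u.
rewrite inE; apply/andP/ffun_onP => [[/forallP uC /bigcupsP uX] i | uX].
  by rewrite inE uC uX.
split; first by apply/forallP=> i; have := uX i; rewrite inE => /andP[].
by apply/bigcupsP=> i _; have := uX i; rewrite inE => /andP[].
Qed.

Lemma comp_reduced_enum (K : realType) n d (f : RE K n d) alpha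
    (a b : {mpoly K[2]}) :
  subst2 (reduced_enum f alpha (poly_x K) (poly_y K)) a b =
  reduced_enum f alpha a b.
Proof.
rewrite /subst2 /reduced_enum raddf_sum; apply: eq_bigr => X _.
by rewrite /= comp_mpolyZ rmorphM !rmorphXn /= !comp_mpolyXU.
Qed.

Lemma reduced_enum_zhomog (K : realType) n d (f : RE K n d) alpha :
  harmonic f ->
  zhomog (n%:Z - (2 * d)%:Z) (reduced_enum f alpha (poly_x K) (poly_y K)).
Proof.
move=> harmf; set p := reduced_enum _ _ _ _.
have [le2dn|lt2dn] := leqP (2 * d) n.
  rewrite subzn //= /p; apply: rpred_sum => X _.
  have [ltXd|leXd] := ltnP #|X| d.
    by rewrite ftilde_small // mul0r scale0r rpred0.
  have [ltXd|leXdC] := ltnP #|~: X| d.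
    by rewrite ftilde_large // mul0r scale0r rpred0.
  rewrite rpredZ //.
  have -> : (n - 2 * d = (1 * (#|~: X| - d)) + (1 * (#|X| - d)))%N.
    rewrite !mul1n addnBA // addnBAC // -subnDA addnn mul2n addnC cardsC.
    by rewrite card_ord.
  by apply: dhomogM; apply: dhomogMn; rewrite dhomogX /= mdeg1.
have -> : p = 0.
  rewrite /p /reduced_enum big1 // => X _.
  have [ltXd|leXd] := ltnP #|X| d.
    by rewrite ftilde_small // mul0r scale0r.
  rewrite ftilde_large ?mul0r ?scale0r //.
  rewrite -(ltn_add2l #|X|) cardsC card_ord.
  by rewrite (leq_trans lt2dn) // mul2n -addnn leq_add2r.
by case: (_ - _) => // k; apply: rpred0.
Qed.

Theorem theorem3p1 (K : realType) (R : finPzRingType) (n d m : nat)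
    (C : {set 'rV[R]_n}) (f : RE K n d) :
  frobenius R -> (d <= n)%N -> (1 <= m)%N ->
  left_linear_code C -> harmonic f ->
  exists Z Zperp : {mpoly K[2]},
    let x := poly_x K in
    let y := poly_y K in
    let q : K := (#|R| ^ m)%:R in
    [/\ whe m C f = (x * y) ^+ d * Z,
        whe m (right_dual C) f = (x * y) ^+ d * Zperp,
        zhomog (n%:Z - (2 * d)%:Z) Z,
        zhomog (n%:Z - (2 * d)%:Z) Zperp
      & Zperp = ((-1) ^+ d * (q ^+ d / (#|C| ^ m)%:R)) *:
                  subst2 Z (x + (q - 1) *: y) (x - y)].
Proof.
move=> frobR _ _ linC harmf.
pose A (D : {set 'rV[R]_n}) X : K := (supp_count m D X)%:R.
pose B (D : {set 'rV[R]_n}) X : K := (#|subcode D X| ^ m)%:R.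
have BE D X : B D X = \sum_(Y : {set 'I_n} | Y \subset X) A D Y.
  by rewrite /B -sum_supp_count natr_sum.
set x := poly_x K; set y := poly_y K.
exists (reduced_enum f (A C) x y), (reduced_enum f (A (right_dual C)) x y).
split.
- exact: (weighted_enumE harmf).
- exact: (weighted_enumE harmf).
- exact: reduced_enum_zhomog.
- exact: reduced_enum_zhomog.
set q : K := (#|R| ^ m)%:R.
have xyU : (x - y) * y != 0.
  rewrite mulf_neq0 //; apply/eqP.
    move/(congr1 (mcoeff U_(ord0))); rewrite mcoeffB !mcoeffXU mcoeff0 subr0.
    exact/eqP/oner_neq0.
  move/(congr1 (mcoeff U_(ord_max))); rewrite mcoeffXU mcoeff0 eqxx.
  exact/eqP/oner_neq0.
have C0 : (#|C| ^ m)%:R != 0 :> K.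
  by rewrite Num.Theory.pnatr_eq0 -lt0n expn_gt0 code_gt0.
have dualB X : B (right_dual C) X = (#|C| ^ m)%:R^-1 * (q ^+ #|X| * B C (~: X)).
  apply: (mulfI C0); rewrite mulVKf //; rewrite /B /q -natrX -!natrM.
  by rewrite -expnAC -!expnMn mulnC card_subcode_dual.
(* At a = x - y and b = y the arguments of the reduced enumerators are (x, y)
   for the dual code and (x + (q - 1) y, x - y) for C. *)
have := reduced_enum_duality harmf (x - y) y (BE C) (BE (right_dual C)) dualB.
move/(mulfI (expf_neq0 d xyU)); rewrite subrK => ->.
have -> : x + (q - 1) *: y = x - y + q *: y.
  by rewrite scalerBl scale1r addrAC addrA.
by rewrite comp_reduced_enum.
Qed.
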